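(* Let $G$ be a finite, simple, connected graph with $v$ vertices, let $k\ge 2$, let $\mathscr{C}=\{C_1,\ldots,C_{\beta(G)}\}$ be a cycle basis of $G$, and let $\mathscr{B}=\Upsilon\cup\Omega$ be the set of Cartesian squares in $G^{(k)}$ constructed below. Fix $f\in M_{k-1}(G)$ and put $\mathscr{C}f=\{C_1f,\ldots,C_{\beta(G)}f\}$. Then $\mathscr{C}f\cup\mathscr{B}$ is a cycle basis of $G^{(k)}$. If moreover $\mathscr{C}$ is a minimum cycle basis of $G$ and $G$ has no triangles, then $\mathscr{C}f\cup\mathscr{B}$ is a minimum cycle basis of $G^{(k)}$.
   Context: The cycle space $\mathscr{C}(H)$ of a graph $H$ is the kernel of the $\mathbb{F}_2$-linear boundary map from the edge space (subsets of $E(H)$, addition = symmetric difference) to the vertex space, $xy\mapsto x+y$; its elements are identified with subgraphs, and $\beta(H)=\dim\mathscr{C}(H)$. A cycle basis is a basis of $\mathscr{C}(H)$; its total length is the sum of the numbers of edges of its elements, and a minimum cycle basis is a cycle basis of smallest total length. $M_k(a_1,\ldots,a_j)$ is the set of monic monomials of degree $k$ in commuting indeterminates $a_1,\ldots,a_j$ ($M_0=\{1\}$), and $M_k(G)=M_k(a_1,\ldots,a_v)$ where $V(G)=\{a_1,\ldots,a_v\}$. The reduced $k$th power $G^{(k)}$ has vertex set $M_k(G)$, with an edge between $ag$ and $bg$ for every edge $ab$ of $G$ and every $g\in M_{k-1}(G)$ (and no others). For an element $C$ of $\mathscr{C}(G)$ (a sum of edges $xy$ of $G$) and $f\in M_{k-1}(G)$,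 $Cf$ is the element of $\mathscr{C}(G^{(k)})$ obtained by replacing each edge $xy$ by $xf\,yf$; e.g. a cycle $c_1c_2\cdots c_n$ yields the cycle $c_1f\,c_2f\cdots c_nf$. For distinct edges $ab,cd$ of $G$ and $g\in M_{k-2}(G)$, the Cartesian square $(ab\Box cd)g$ is the sum of the edges $acg\,bcg$, $bcg\,bdg$, $bdg\,adg$, $adg\,acg$. Construction of $\mathscr{B}$: take a rooted spanning tree $T$ of $G$ with vertices labelled $a_1,\ldots,a_v$ so that $a_1$ is the root and for each $i$, $a_i$ is not closer to the root than any $a_j$ with $j<i$; for $2\le j\le v$ let $e_j$ be the edge of $T$ joining $a_j$ to its neighbour closer to the root; $\Upsilon=\{(e_i\Box e_j)g \mid 2\le i<j\le v,\ g\in M_{k-2}(a_1,\ldots,a_j)\}$, $\Omega=\{(a_\ell a_m\Box e_j)g \mid a_\ell a_m\in E(G)\setminus E(T),\ 2\le j\le v,\ g\in M_{k-2}(a_1,\ldots,a_j)\}$, and $\mathscr{B}=\Upsilon\cup\Omega$. *)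

(* Defs.v *)
From HB Require Import structures.
From mathcomp Require Import all_boot all_order all_algebra.
From mathcomp Require Import finmap.
From mathcomp Require Import monalg.

Set Implicit Arguments.
Unset Strict Implicit.
Unset Printing Implicit Defensive.

Import GRing.Theory.

Local Open Scope ring_scope.

Record sgraph := SGraph {
  vertex :> finType;
  adj : rel vertex;
  adj_sym : symmetric adj;
  adj_irr : irreflexive adj }.

Arguments adj {s}.

Definition connected_rel (T : finType) (e : rel T) : Prop :=
  forall x y : T, connect e x y.

Definition connected (G : sgraph) : Prop := connected_rel (@adj G).

Definition triangle_free (G : sgraph) : Prop :=
  forall x y z : G, ~~ [&& adj x y, adj y z & adj z x].

Definition edge_set (H : sgraph) : {set {set H}} :=
  [set [set p.1; p.2] | p : H * H & adj p.1 p.2].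

Notation edge H := {A : {set H} | A \in edge_set H}.

(* Subsets of E(H) are represented by their indicator functions, so that
   addition is the symmetric difference. The regular module of 'F_2 is what
   gives the function space its vectType structure. *)
Notation chain H := {ffun edge H -> ('F_2)^o}.
Notation vchain H := {ffun vertex H -> ('F_2)^o}.

Definition vertex_chain (H : sgraph) (x : H) : vchain H :=
  [ffun y => (y == x)%:R].

(* Meant for S an edge; it is 0 otherwise. *)
Definition edge_chain (H : sgraph) (S : {set H}) : chain H :=
  [ffun A : edge H => (val A == S)%:R].

Definition boundary (H : sgraph) (z : chain H) : vchain H :=
  \sum_(A : edge H) z A *: \sum_(x in val A) vertex_chain x.

Fact boundary_is_linear (H : sgraph) : linear (@boundary H).
Proof.
move=> c z w; rewrite /boundary scaler_sumr -big_split /=.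
by apply: eq_bigr => A _; rewrite !ffunE scalerDl scalerA.
Qed.

HB.instance Definition _ (H : sgraph) :=
  GRing.isLinear.Build 'F_2 (chain H) (vchain H) _ (@boundary H)
    (@boundary_is_linear H).

Definition cycle_space (H : sgraph) : {vspace chain H} :=
  lker (linfun (@boundary H)).

Definition chain_length (H : sgraph) (z : chain H) : nat :=
  #|[set A : edge H | z A != 0]|.

Definition cycle_basis (H : sgraph) (B : {set chain H}) : Prop :=
  basis_of (cycle_space H) (enum B).

Definition total_length (H : sgraph) (B : {set chain H}) : nat :=
  (\sum_(z in B) chain_length z)%N.

Definition min_cycle_basis (H : sgraph) (B : {set chain H}) : Prop :=
  cycle_basis B /\
  forall B' : {set chain H}, cycle_basis B' ->
    (total_length B <= total_length B')%N.

Definition mono (V : finType) (k : nat) : predArgType :=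
  {m : {cmonom V} | mdeg m == k}.

HB.instance Definition _ (V : finType) (k : nat) :=
  SubChoice.on (mono V k).

Section MonoFinite.
Variables (V : finType) (k : nat).

Let encode (m : mono V k) : {ffun V -> 'I_k.+1} :=
  [ffun x => inord (val m x)].

Let decode (h : {ffun V -> 'I_k.+1}) : option (mono V k) :=
  insub [cmonom (h x : nat) | x in [fset y | y in enum V]%fset]%M.

Let encodeK : pcancel encode decode.
Proof.
move=> m; rewrite /decode.
suff -> : [cmonom (encode m x : nat) | x in [fset y | y in enum V]%fset]%M
          = val m by rewrite valK.
apply/eqP/cmP => x; rewrite cmE fsfun_fun in_fset mem_enum inE ffunE inordK //.
rewrite ltnS; apply: leq_trans (eq_leq (eqP (valP m))); rewrite mdegE.
by case: (mdomP (val m) x) => // xm; rewrite (big_fsetD1 x xm) leq_addr.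
Qed.

HB.instance Definition _ := PCanIsCountable encodeK.
HB.instance Definition _ := isFinite.Build (mono V k) (pcan_enumP encodeK).

End MonoFinite.

Local Notation "x * y" := (mmul x y) : monom_scope.
Local Notation "'U_(' x )" := (ucm x) : monom_scope.

Section ReducedPower.
Variables (G : sgraph) (k : nat).

Definition rpower_adj (m m' : mono G k) : bool :=
  [exists p : G * G, exists g : mono G (k - 1),
    [&& adj p.1 p.2, val m == (U_(p.1) * val g)%M
      & val m' == (U_(p.2) * val g)%M]].

Fact rpower_adj_sym : symmetric rpower_adj.
Proof.
suff sub m m' : rpower_adj m m' -> rpower_adj m' m.
  by move=> m m'; apply/idP/idP; apply: sub.
case/existsP=> -[a b] /existsP[g /and3P[ab ma mb]].
by apply/existsP; exists (b, a); apply/existsP; exists g; rewrite adj_sym ab mb.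
Qed.

Fact rpower_adj_irr : irreflexive rpower_adj.
Proof.
move=> m; apply/existsP => -[[a b] /existsP[g /and3P[/= ab /eqP-> /cmP/(_ a)]]].
rewrite !cmM !cmU eqxx => /addIn; case: eqP => // ba _.
by move: ab; rewrite ba adj_irr.
Qed.

Definition rpower : sgraph := SGraph rpower_adj_sym rpower_adj_irr.

(* The vertices of the reduced power listed in s; monomials of s whose degree
   is not k, which never occur below, are dropped. *)
Definition mono_set (s : seq {cmonom G}) : {set rpower} :=
  [set m : rpower | (val m : {cmonom G}) \in s].

Definition lift_chain (f : mono G (k - 1)) (z : chain G) : chain rpower :=
  \sum_(A : edge G)
    z A *: edge_chain (mono_set [seq (U_(x) * val f)%M | x <- enum (val A)]).

(* (ab [] cd) g *)
Definition square (a b c d : G) (g : mono G (k - 2)) : chain rpower :=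
  let v x y := (U_(x) * U_(y) * val g)%M in
  edge_chain (mono_set [:: v a c; v b c]) +
  edge_chain (mono_set [:: v b c; v b d]) +
  edge_chain (mono_set [:: v b d; v a d]) +
  edge_chain (mono_set [:: v a d; v a c]).

End ReducedPower.

(* e is meant symmetric: an edge run through back and forth is a ucycle of
   size 2. *)
Definition acyclic (T : eqType) (e : rel T) : Prop :=
  forall c : seq T, ucycle e c -> (size c <= 2)%N.

Definition spanning_tree (G : sgraph) (t : rel G) : Prop :=
  [/\ symmetric t, subrel t adj, connected_rel t & acyclic t].

(* Number of edges of a shortest path from x to y; #|T| if there is none. *)
Definition dist (T : finType) (e : rel T) (x y : T) : nat :=
  find (fun n => [exists p : n.-tuple T, path e x p && (last x p == y)])
       (iota 0 #|T|).

(* The labels are shifted: a i stands for a_(i+1), so a_1 is a 0. *)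
Definition rooted_labelling (G : sgraph) (t : rel G) (r : G)
    (v : nat) (a : 'I_v -> G) : Prop :=
  [/\ bijective a,
      forall i : 'I_v, i = 0%N :> nat -> a i = r
    & forall i j : 'I_v, (j < i)%N -> (dist t r (a j) <= dist t r (a i))%N].

Section Squares.
Variables (G : sgraph) (k : nat) (t : rel G) (r : G) (v : nat) (a : 'I_v -> G).

(* The neighbour of x in t closer to r (unique when t is a tree and x <> r). *)
Definition parent (x : G) : G :=
  odflt x [pick y | t x y & (dist t r y < dist t r x)%N].

(* g only involves the indeterminates a 0, ..., a j. *)
Definition mono_upto (n : nat) (j : 'I_v) (g : mono G n) : bool :=
  [forall i : 'I_v, (j < i)%N ==> (val g (a i) == 0%N)].

Definition Upsilon : {set chain (rpower G k)} :=
  [set z | [exists i : 'I_v, exists j : 'I_v, exists g : mono G (k - 2),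
    [&& (0 < i < j)%N, mono_upto j g
      & z == square (a i) (parent (a i)) (a j) (parent (a j)) g]]].

Definition Omega : {set chain (rpower G k)} :=
  [set z | [exists p : G * G, exists j : 'I_v, exists g : mono G (k - 2),
    [&& adj p.1 p.2 && ~~ t p.1 p.2, (0 < j)%N, mono_upto j g
      & z == square p.1 p.2 (a j) (parent (a j)) g]]].

Definition square_set : {set chain (rpower G k)} := Upsilon :|: Omega.

End Squares.

(* Main.v *)
Require Import Defs.
From HB Require Import structures.
From mathcomp Require Import all_boot all_order all_algebra.
From mathcomp Require Import finmap monalg zify.

(* An edge of the power is a pair (e, g) of an edge e of G and a monomial g of
   degree k - 1. So the edge space is a sum over E(G) of copies of the degree
   k - 1 polynomials over F_2, the boundary multiplies the e-component, e = ab,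
   by a + b, and the Cartesian squares are the Koszul syzygies.
   Forgetting g maps cycles of the power to cycles of G; this projection kills
   the squares and is a left inverse of C |-> Cf, so all that is needed is that
   the squares are a basis of its kernel. For a suitable rank the square
   (e [] e_j) g of B has the leading edge (e, a_j g), and these leading edges are
   distinct, hence B is free. A cycle in the kernel can be reduced to one that
   vanishes at all the leading edges; the other edges are the (e, a_1^(k-1))
   with e outside the tree, which the projection controls, and the edges of a
   spanning tree of the power.
   For minimality, the projection does not increase lengths, so in any cycle
   basis of the power some elements that project onto a basis of G are together
   at least as long as C, and each of the others has length at least 4. *)

Set Implicit Arguments.
Unset Strict Implicit.
Unset Printing Implicit Defensive.

Import GRing.Theory.

Local Open Scope ring_scope.

(** * Leading coordinates and cycle spaces *)

Section Leading.
Variables (F : fieldType) (X : finType) (rk : X -> nat).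
Local Notation V := {ffun X -> F^o}.

(** The rank need not be injective: only ties with the leading coordinate itself are excluded. *)
Definition leads (z : V) (x : X) : bool :=
  (z x != 0) && [forall y, (z y != 0) ==> (y != x) ==> (rk y < rk x)%N].

Lemma leadsP (z : V) x :
  reflect (z x != 0 /\ forall y, z y != 0 -> y != x -> (rk y < rk x)%N)
          (leads z x).
Proof.
apply: (iffP andP) => -[zx h]; split=> //.
  by move=> y zy yx; move/forallP/(_ y): h; rewrite zy yx.
by apply/forallP => y; apply/implyP => zy; apply/implyP; apply: h.
Qed.

Lemma leads_inj (z : V) x y : leads z x -> leads z y -> x = y.
Proof.
move=> /leadsP[zx hx] /leadsP[zy hy]; apply/eqP/negPn/negP => xy.
have := ltn_trans (hy x zx xy) (hx y zy _); rewrite ltnn eq_sym => h.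
by have := h xy.
Qed.

Variable B : seq V.
Hypothesis B_leads : forall z, z \in B -> exists x, leads z x.
Hypothesis B_inj : forall z w x, z \in B -> w \in B ->
  leads z x -> leads w x -> z = w.

(** Among the terms with a nonzero coefficient, one whose leading coordinate has maximal rank is
    alone in contributing at that coordinate. *)
Lemma leads_free : uniq B -> free B.
Proof.
move=> uB; apply/(@freeP _ _ _ (in_tuple B)) => c sum0.
have /fin_all_exists[p pP] (i : 'I_(size B)) : exists x, leads B`_i x.
  by apply: B_leads; apply: mem_nth.
move=> i0; apply/eqP/negPn/negP => ci0.
have [i ci imax] := @arg_maxnP _ i0 (fun i => c i != 0) (fun i => rk (p i)) ci0.
have /ffunP/(_ (p i)) := sum0; rewrite sum_ffunE (bigD1 i) //= big1 => [|j ji].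
  rewrite !ffunE addr0 => /eqP; rewrite mulf_eq0 (negbTE ci) /=.
  by have /leadsP[/negbTE-> _] := pP i.
rewrite !ffunE; apply/eqP; rewrite mulf_eq0; apply: contraT.
rewrite negb_or => /andP[cj].
case: (eqVneq (p i) (p j)) => [pij|pij] bj.
  have /eqP := B_inj (mem_nth 0 (ltn_ord j)) (mem_nth 0 (ltn_ord i)) (pP j)
    (eq_ind _ (leads _) (pP i) _ pij).
  by rewrite nth_uniq // => /eqP/val_inj/eqP; rewrite (negbTE ji).
have /leadsP[_ /(_ _ bj pij)] := pP j.
by rewrite ltnNge (imax j cj : (_ <= _)%N).
Qed.

(** Gaussian elimination from the highest rank downwards; the induction is on a bound for the ranks
    of the leading coordinates not yet cleared. *)
Lemma leads_reduce (z : V) : exists2 u, u \in <<B>>%VS &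
  forall w x, w \in B -> leads w x -> (z - u) x = 0.
Proof.
pose N := (\max_x rk x).+1.
have : forall w x, w \in B -> leads w x -> (N <= rk x)%N -> z x = 0.
  by move=> w x _ _; rewrite ltnNge (leq_bigmax x).
move: N z; elim=> [|n IHn] z zP.
  by exists 0 => [|w x Bw wx]; rewrite ?mem0v // subr0 (zP w).
pose p (w : V) := [pick x | leads w x].
(* Only elements leading at rank exactly [n] are subtracted: they clear that rank and vanish at all
   coordinates of higher rank. *)
pose q w := if p w is Some x then
  if rk x == n then z x / w x else 0 else 0.
pose u0 := \sum_(w <- undup B) q w *: w.
have u0E x : u0 x = \sum_(w <- undup B) q w * w x.
  by rewrite sum_ffunE; apply: eq_bigr => w _; rewrite !ffunE.
have [|u uB uP] := IHn (z - u0); last first.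
  exists (u0 + u) => [|w x Bw wx]; last by rewrite opprD addrA (uP w).
  apply: memvD => //; rewrite /u0 big_seq; apply: memv_suml => w wB.
  by apply: memvZ; apply: memv_span; rewrite -mem_undup.
move=> w x Bw wx nx; rewrite !ffunE u0E.
rewrite (bigD1_seq w) ?undup_uniq ?mem_undup //= big1_seq => [|w' /andP[w'w]].
  rewrite addr0 /q /p; case: pickP => [y wy|/(_ x)]; last by rewrite wx.
  rewrite -(leads_inj wx wy); have /leadsP[w0 _] := wx.
  case: eqP => [_|/eqP xn]; first by rewrite divfK // subrr.
  by rewrite mul0r subr0 (zP w) // ltn_neqAle eq_sym xn.
rewrite mem_undup /q /p => Bw'; case: pickP => [y wy|_]; last by rewrite mul0r.
case: eqP => [yn|]; rewrite ?mul0r //.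
apply/eqP; rewrite mulf_eq0 orbC; apply/orP; left; apply/negPn/negP => w'x.
have /leadsP[_ lt] := wy.
case: (eqVneq x y) => [xy|xy].
  by rewrite -xy in wy; rewrite (B_inj Bw' Bw wy wx) eqxx in w'w.
by have := lt x w'x xy; rewrite yn ltnNge nx.
Qed.

End Leading.

(** Serves to pick, from a cycle basis of the power, cycles that project onto a cycle basis of
    [G]. *)
Lemma free_image_subseq (F : fieldType) (U W : vectType F)
    (h : U -> W) (s : seq U) :
  exists s', [/\ subseq s' s, free (map h s')
    & <<map h s'>>%VS = <<map h s>>%VS].
Proof.
elim: s => [|x s [s' [ss fs es]]].
  by exists [::]; split=> //=; apply: nil_free.
have [xin|xout] := boolP (h x \in <<map h s'>>%VS).
  exists s'; split=> //; first exact: subseq_trans ss (subseq_cons _ _).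
  by rewrite /= span_cons -es; apply/esym/addv_idPr; rewrite -memvE.
exists (x :: s'); split=> /=; first by rewrite eqxx.
  by rewrite free_cons xout.
by rewrite !span_cons es.
Qed.

Lemma F2_addrr (c : 'F_2) : c + c = 0.
Proof. by case: c => -[|[|[]]] // i; apply: val_inj. Qed.

Lemma chain_addrr (H : sgraph) (z : chain H) : z + z = 0.
Proof. by apply/ffunP => A; rewrite !ffunE F2_addrr. Qed.

Lemma chain_neq0 (H : sgraph) (z : chain H) : z != 0 -> exists A, z A != 0.
Proof.
move=> z0; apply/existsP; apply: contraNT z0 => /existsPn h; apply/eqP/ffunP => A.
by rewrite ffunE; apply/eqP; have := h A; rewrite negbK.
Qed.

(** * Cycle spaces: parity at a vertex, and short cycles *)

Section Cycles.
Variable H : sgraph.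
Implicit Types (z : chain H) (x : H).

Lemma edgeP (A : edge H) : exists x y, adj x y /\ val A = [set x; y].
Proof. by have /imsetP[[x y]/= xy] := valP A; rewrite inE in xy; exists x, y. Qed.

Fact edge_subproof x y : adj x y -> [set x; y] \in edge_set H.
Proof. by move=> xy; apply/imsetP; exists (x, y); rewrite ?inE. Qed.

Definition mkedge x y (xy : adj x y) : edge H := exist _ [set x; y] (edge_subproof xy).

Lemma adj_neq x y : adj x y -> x != y.
Proof. by apply: contraTneq => ->; rewrite adj_irr. Qed.

Lemma boundaryE z x : boundary z x = \sum_(A : edge H | x \in val A) z A.
Proof.
rewrite sum_ffunE [RHS]big_mkcond /=; apply: eq_bigr => A _.
rewrite !ffunE sum_ffunE; case: ifP => xA.
  rewrite (bigD1 x) //= big1 => [|y /andP[_ yx]]; rewrite ffunE ?eqxx.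
    by rewrite addr0; apply: mulr1.
  by rewrite eq_sym (negbTE yx).
rewrite big1 => [|y yA]; first by apply: mulr0.
by rewrite ffunE; case: eqP => // xy; rewrite xy yA in xA.
Qed.

Lemma cycle_spaceP z :
  reflect (forall x, \sum_(A : edge H | x \in val A) z A = 0)
          (z \in cycle_space H).
Proof.
rewrite memv_ker lfunE /=; apply: (iffP eqP) => [z0 x|z0].
  by rewrite -boundaryE z0 ffunE.
by apply/ffunP => x; rewrite boundaryE z0 ffunE.
Qed.

(** The coefficients at [x] sum to zero, so [A] cannot carry the only nonzero one. *)
Lemma cycle_other_edge z x (A : edge H) : z \in cycle_space H ->
  z A != 0 -> x \in val A ->
  exists B : edge H, [/\ z B != 0, x \in val B & B != A].
Proof.
move=> /cycle_spaceP/(_ x) z0 zA xA.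
suff /existsP[B /and3P[]] :
  [exists B : edge H, [&& z B != 0, x \in val B & B != A]] by exists B.
apply: contraNT zA => /existsPn h.
move: z0; rewrite (bigD1 A) //= big1 ?addr0 => [->|B /andP[xB BA]] //.
by apply/eqP; have := h B; rewrite xB BA !andbT negbK.
Qed.

Lemma edge_other (A : edge H) x : x \in val A ->
  exists2 y, adj x y & val A = [set x; y].
Proof.
have [u [w [uw ->]]] := edgeP A; rewrite !inE => /orP[]/eqP->.
  by exists w.
by exists u; rewrite 1?adj_sym // setUC.
Qed.

(** A support edge [xy] continues to edges [yw] and [xu] of the support. Without triangles [w] and
    [u] differ, so a second edge at [w] is a fourth one. *)
Lemma cycle_length_ge4 z : triangle_free H -> z \in cycle_space H -> z != 0 ->
  (4 <= chain_length z)%N.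
Proof.
move=> tf zC /chain_neq0[A zA].
have [x [y [xy EA]]] := edgeP A.
have xA : x \in val A by rewrite EA !inE eqxx.
have yA : y \in val A by rewrite EA !inE eqxx orbT.
have [B [zB yB BA]] := cycle_other_edge zC zA yA.
have [w yw EB] := edge_other yB.
have [D [zD xD DA]] := cycle_other_edge zC zA xA.
have [u xu ED] := edge_other xD.
have wB : w \in val B by rewrite EB !inE eqxx orbT.
have [E [zE wE EnB]] := cycle_other_edge zC zB wB.
have wx : w != x.
  by apply: contraNneq BA => wx; rewrite -val_eqE /= EA EB wx setUC.
have uy : u != y.
  by apply: contraNneq DA => uy; rewrite -val_eqE /= EA ED uy.
have wu : w != u.
  apply/eqP => wu; have := tf x y u; rewrite xy -wu yw adj_sym.
  by rewrite wu xu.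
have wy : w != y by rewrite eq_sym adj_neq.
have yx : y != x by rewrite eq_sym adj_neq.
have AD : w \notin val A by rewrite EA !inE negb_or wx wy.
have wD : w \notin val D by rewrite ED !inE negb_or wx wu.
have yD : y \notin val D by rewrite ED !inE negb_or yx eq_sym uy.
suff /card_uniqP E4 : uniq [:: A; B; D; E].
  rewrite -[4%N]/(size [:: A; B; D; E]) -E4; apply/subset_leq_card/subsetP => e.
  by rewrite !inE => /or4P[]/eqP->.
have neq (P Q : edge H) s : s \in val P -> s \notin val Q -> P != Q.
  by move=> sP; apply: contraNneq => <-.
rewrite /= !inE !negb_or (eq_sym A B) BA (eq_sym A D) DA (eq_sym A E).
by rewrite (neq E A w) // (neq B D y) // (eq_sym B E) EnB (eq_sym D E) (neq E D w).
Qed.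

End Cycles.

(** * Rooted spanning trees *)

Section Dist.
Variables (T : finType) (e : rel T) (r : T).

Lemma dist_le_size p : path e r p -> (dist e r (last r p) <= size p)%N.
Proof.
move=> rp; rewrite /dist; set P := fun n => _; set s := iota _ _.
(* Long paths fall under the default value, as [find] never exceeds the length of the list. *)
have [lt|le] := ltnP (size p) #|T|; last first.
  by apply: leq_trans le; rewrite -(size_iota 0 #|T|) find_size.
rewrite leqNgt; apply/negP => /(before_find 0%N).
rewrite nth_iota // add0n => /negbT/negP; apply; rewrite /P; apply/existsP.
by exists (in_tuple p); rewrite rp eqxx.
Qed.

Lemma dist_path x : connect e r x ->
  exists p, [/\ path e r p, last r p = x & size p = dist e r x].
Proof.
case/connectP => p0 /shortenP[p rp up _] ->.
rewrite /dist; set P := (P in find P _); set s := iota _ _.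
have lt : (size p < #|T|)%N.
  by have := max_card [in r :: p]; rewrite (card_uniqP up).
have hP : has P s.
  apply/hasP; exists (size p); first by rewrite mem_iota.
  by apply/existsP; exists (in_tuple p); rewrite rp eqxx.
have := nth_find 0%N hP; have := hP; rewrite has_find size_iota => hs.
rewrite nth_iota // add0n => /existsP[q /andP[rq /eqP lq]].
by exists q; rewrite size_tuple.
Qed.

End Dist.

Section Tree.
Variables (G : sgraph) (t : rel G) (r : G).
Hypothesis t_tree : spanning_tree t.

(** The vertex before [x] on a shortest path from [r] qualifies, so the default in [parent] is not
    reached. *)
Lemma parentP x : x != r ->
  t x (parent t r x) /\ (dist t r (parent t r x) < dist t r x)%N.
Proof.
have [tS _ tC _] := t_tree => xr; rewrite /parent.
case: pickP => [y /andP[]|h] //.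
have [p [rp lp sp]] := dist_path (tC r x).
case/lastP: p => [|p y] in rp lp sp *; first by rewrite -lp eqxx in xr.
move: rp lp sp; rewrite rcons_path last_rcons size_rcons => /andP[rp ty] yx sp.
by have := h (last r p); rewrite tS -yx ty /= yx -sp ltnS dist_le_size.
Qed.

(* If x y were not a parent edge, the parent edges would still join x to y,
   and closing up with x y would give a cycle. *)
Lemma tree_edge_parent x y : t x y ->
  (x != r /\ y = parent t r x) \/ (y != r /\ x = parent t r y).
Proof.
have [tS tA tC tN] := t_tree => txy.
pose q := [rel u w | (u != r) && (w == parent t r u)].
pose e := [rel u w | q u w || q w u].
have eS : symmetric e by move=> u w; rewrite /= orbC.
have et : subrel e t.
  move=> u w /= /orP[]/andP[/parentP[h _] /eqP->] //.
  by rewrite tS.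
have er u : connect e u r.
  have [n] := ubnP (dist t r u); elim: n u => // n IHn u un.
  have [->|ur] := eqVneq u r; first exact: connect0.
  have [_ lt] := parentP ur.
  apply: (@connect_trans _ e (parent t r u)).
    by apply: connect1; rewrite /= ur eqxx.
  by apply: IHn; apply: leq_trans lt _.
have exy : connect e x y.
  by apply: connect_trans (er x) _; rewrite (sym_connect_sym eS).
have [/orP[]/andP[? /eqP] |nexy] := boolP (e x y); [by left|by right|].
case/connectP: exy => p0 /shortenP[p xp up _] yE; exfalso.
have /tN/= : ucycle t (x :: p).
  rewrite /ucycle up andbT /= rcons_path (sub_path et xp) /= -yE.
  by rewrite tS.
have xy := adj_neq (tA _ _ txy).
(* Acyclicity leaves at most one vertex after [x]: none would mean [y = x], and one that [x y] is a
   parent edge after all. *)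
case: p xp up yE => [|z [|]] //= ; first by move=> _ _ yx; rewrite yx eqxx in xy.
by rewrite andbT => + _ zy; rewrite -zy; rewrite /= in nexy; rewrite (negbTE nexy).
Qed.

Variables (v : nat) (a : 'I_v -> G).
Hypothesis a_lab : rooted_labelling t r a.

Fact label_ex (x : G) : exists i, a i == x.
Proof. by have [[b _ bK] _ _] := a_lab; exists (b x); rewrite bK. Qed.

Definition label (x : G) : 'I_v := xchoose (label_ex x).

Lemma labelK : cancel label a.
Proof. by move=> x; apply/eqP; exact: (xchooseP (label_ex x)). Qed.

Lemma a_inj : injective a.
Proof. by have [/bij_inj] := a_lab. Qed.

Lemma aK : cancel a label.
Proof. by move=> i; apply: a_inj; rewrite labelK. Qed.

Lemma label_gt0 x : (0 < label x)%N = (x != r).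
Proof.
have [_ a0 _] := a_lab; have [->|xr] := eqVneq x r.
  apply/negbTE; rewrite -eqn0Ngt; apply/eqP.
  (* [label r] witnesses that [v] is positive, so the index 0 exists. *)
  have i0 := leq_ltn_trans (leq0n _) (ltn_ord (label r)).
  by rewrite -(a0 (Ordinal i0)) // aK.
by rewrite lt0n; apply: contra xr => /eqP/a0; rewrite labelK => ->.
Qed.

(** The parent is strictly closer to the root, whereas a vertex with a larger label never is. *)
Lemma label_parent x : x != r -> (label (parent t r x) < label x)%N.
Proof.
have [_ _ aD] := a_lab => /parentP[txp lt]; rewrite ltnNge leq_eqVlt.
apply/norP; split; last first.
  by apply/negP => /aD; rewrite !labelK leqNgt lt.
have [_ tA _ _] := t_tree.
by apply: contraNN (adj_neq (tA _ _ txp)) => /eqP/val_inj/(can_inj labelK)/eqP.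
Qed.

Lemma a_neq_root (j : 'I_v) : (0 < j)%N -> a j != r.
Proof. by rewrite -label_gt0 aK. Qed.

Lemma adj_parent x : x != r -> adj x (parent t r x).
Proof. by have [_ tA _ _] := t_tree => /parentP[/tA]. Qed.

(** Otherwise [x] and [y] would be each other's parents, and labels would decrease both ways. *)
Lemma parent_edge_inj x y : x != r -> y != r ->
  [set x; parent t r x] = [set y; parent t r y] -> x = y.
Proof.
move=> xr yr E; apply/eqP/negPn/negP => xy.
have : x \in [set y; parent t r y] by rewrite -E !inE eqxx.
rewrite !inE (negbTE xy) /= => /eqP xE.
have : y \in [set x; parent t r x] by rewrite E !inE eqxx.
rewrite !inE eq_sym (negbTE xy) /= => /eqP yE.
have yx : (label y < label x)%N by rewrite {1}yE label_parent.
have lxy : (label x < label y)%N by rewrite {1}xE label_parent.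
by have := ltn_trans yx lxy; rewrite ltnn.
Qed.

End Tree.

(** * Edges of the reduced power *)

(* The sum over the four edges of a square, with the 0 that big_nil leaves. *)
Lemma F2_square (p q s u : 'F_2) : p + q + (q + u + (s + u + (p + s + 0))) = 0.
Proof.
rewrite addr0 (addrC s u) (addrC p s) (addrA (u + s)) -(addrA u s s) F2_addrr addr0.
by rewrite (addrA (q + u)) -(addrA q u u) F2_addrr addr0 (addrC q p) F2_addrr.
Qed.

(** * Multiplying and dividing monomials by a variable *)

Section MonoMul.
Variables (V : finType) (n n' : nat) (nn' : n.+1 = n').

Fact mono_mul_subproof x (g : mono V n) : mdeg (mmul (ucm x) (val g)) == n'.
Proof. by rewrite mdegM mdegU (eqP (valP g)) add1n nn'. Qed.

(** The equation between [n.+1] and [n'] links the degrees [k - 2], [k - 1] and [k] without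
    casts. *)
Definition mono_mul x (g : mono V n) : mono V n' :=
  exist _ (mmul (ucm x) (val g)) (mono_mul_subproof x g).

Lemma mono_mulE x (g : mono V n) y : val (mono_mul x g) y = ((x == y) + val g y)%N.
Proof. by rewrite cmM cmU. Qed.

Lemma mono_eqP m (g h : mono V m) : (forall y, val g y = val h y) -> g = h.
Proof. by move=> gh; apply: val_inj; apply/eqP/cmP. Qed.

Lemma mono_mul_injl g : injective (mono_mul^~ g).
Proof.
move=> x y /(congr1 (fun h : mono V n' => val h x)); rewrite !mono_mulE eqxx.
by move/addIn/esym; case: eqP.
Qed.

Lemma mono_mul_injr x : injective (mono_mul x).
Proof.
move=> g h E; apply: mono_eqP => y.
have /(congr1 (fun h : mono V n' => val h y)) := E.
by rewrite !mono_mulE => /addnI.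
Qed.

(** Comparing the exponents of [x] in both equations forces [x' = x], which then cancels. Hence an
    edge of the power determines its monomial. *)
Lemma mono_mul_inj2 x y x' y' g h : x != y ->
  mono_mul x g = mono_mul x' h -> mono_mul y g = mono_mul y' h ->
  g = h.
Proof.
move=> xy Ex Ey; suff xx : x' = x by rewrite xx in Ex; apply: mono_mul_injr Ex.
have /(congr1 (fun h : mono V n' => val h x)) := Ex.
have /(congr1 (fun h : mono V n' => val h x)) := Ey.
rewrite !mono_mulE eqxx eq_sym (negbTE xy) add0n => -> /eqP.
by rewrite addnA eqn_add2r; case: (x' =P x) => // _; case: (_ == x).
Qed.

Lemma mono_div x (m : mono V n') : (0 < val m x)%N -> exists g, m = mono_mul x g.
Proof.
move=> mx; have E : mmul (ucm x) (divcm (val m) (ucm x)) = val m.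
  apply/eqP/cmP => y; rewrite cmM divcmE cmU.
  by case: eqP => [<-|_]; rewrite ?subnKC // subn0.
have dg : mdeg (divcm (val m) (ucm x)) == n.
  have := congr1 mdeg E; rewrite mdegM mdegU (eqP (valP m)) add1n.
  by move=> /eqP; rewrite -[X in _ == X -> _]nn' eqSS.
by exists (exist (fun h : {cmonom V} => mdeg h == n) _ dg); apply: val_inj; rewrite /= E.
Qed.

End MonoMul.

Lemma mono_mulC (V : finType) n n' n'' (e : n.+1 = n') (e' : n'.+1 = n'') x y
    (g : mono V n) :
  mono_mul e' x (mono_mul e y g) = mono_mul e' y (mono_mul e x g).
Proof. by apply: mono_eqP => z; rewrite !mono_mulE addnCA. Qed.

Lemma mono_neq1 (V : finType) n (m : mono V n) : (0 < n)%N ->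
  exists x, (0 < val m x)%N.
Proof.
move=> n0; apply/existsP; apply: contraLR n0 => /existsPn m0.
rewrite -(eqP (valP m)) -eqn0Ngt mdeg_eq0; apply/cmP => x.
by rewrite cm1; apply/eqP; rewrite eqn0Ngt.
Qed.

Section ChainEdge.
Variable H : sgraph.

Lemma val_mkedge (x y : H) (xy : adj x y) : val (mkedge xy) = [set x; y].
Proof. by []. Qed.

Lemma edge_chainE (Q R : edge H) : edge_chain (val Q) R = (R == Q)%:R.
Proof. by rewrite ffunE. Qed.

Lemma sum_edge_chain (P : pred (edge H)) (Q : edge H) :
  \sum_(R : edge H | P R) edge_chain (val Q) R = (P Q)%:R.
Proof.
rewrite big_mkcond (bigD1 Q) //= big1 => [|R RQ].
  by rewrite edge_chainE eqxx addr0; case: (P Q).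
by rewrite edge_chainE (negbTE RQ) if_same.
Qed.

Lemma chain_length_edge_chains (s : seq (edge H)) (z : chain H) :
  z = \sum_(Q <- s) edge_chain (val Q) -> (chain_length z <= size s)%N.
Proof.
move=> ->; apply: leq_trans (card_size s); apply/subset_leq_card/subsetP => R.
rewrite inE; apply: contraR => Rs; rewrite sum_ffunE big1_seq // => Q /andP[_ Qs].
by rewrite edge_chainE; case: eqP Rs => // ->; rewrite Qs.
Qed.

End ChainEdge.

(** * Edge coordinates of the power, the lift, the projection and the squares *)

Section Power.
Variables (G : sgraph) (k : nat).
Hypothesis k_ge2 : (2 <= k)%N.

Fact power_succ1 : (k - 1).+1 = k.
Proof. by rewrite subn1 prednK // ltnW. Qed.

Fact power_succ2 : (k - 2).+1 = (k - 1)%N.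
Proof. by rewrite -subSn // subSS. Qed.

Notation P := (rpower G k).
Definition vmul (x : G) (g : mono G (k - 1)) : P := mono_mul power_succ1 x g.
Definition gmul (x : G) (g : mono G (k - 2)) : mono G (k - 1) :=
  mono_mul power_succ2 x g.

Lemma rpower_adjP (m m' : P) :
  reflect (exists x y g, [/\ adj x y, m = vmul x g & m' = vmul y g]) (adj m m').
Proof.
apply: (iffP existsP) => [[[x y] /existsP[g /and3P[/= xy mx my]]]|].
  by exists x, y, g; split=> //; apply: val_inj; apply/eqP.
move=> [x [y [g [xy -> ->]]]]; exists (x, y); apply/existsP; exists g.
by rewrite xy /= !eqxx.
Qed.

Fact power_edge_subproof (A : edge G) (g : mono G (k - 1)) :
  [set vmul x g | x in val A] \in edge_set P.
Proof.
have [x [y [xy ->]]] := edgeP A; rewrite imsetU1 imset_set1.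
by apply: edge_subproof; apply/rpower_adjP; exists x, y, g.
Qed.

Definition power_edge (A : edge G) (g : mono G (k - 1)) : edge P :=
  exist (fun S : {set P} => S \in edge_set P) _ (power_edge_subproof A g).

Lemma val_power_edge (A : edge G) g x y : val A = [set x; y] ->
  val (power_edge A g) = [set vmul x g; vmul y g].
Proof.
move=> EA; rewrite -[LHS]/[set vmul u g | u in val A] EA.
by rewrite imsetU1 imset_set1.
Qed.

Lemma mem_vmul x (A : edge G) g : (vmul x g \in val (power_edge A g)) = (x \in val A).
Proof. exact: mem_imset (mono_mul_injl (g := g)). Qed.

Lemma power_edge_inj A A' g g' : power_edge A g = power_edge A' g' ->
  A = A' /\ g = g'.
Proof.
move=> /(congr1 val); rewrite -[val (power_edge A g)]/[set vmul u g | u in val A].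
rewrite -[val (power_edge A' g')]/[set vmul u g' | u in val A'] => E.
have [x [y [xy EA]]] := edgeP A.
have memA z : z \in val A -> exists2 z', z' \in val A' & vmul z g = vmul z' g'.
  by move=> zA; apply/imsetP; rewrite -E; apply/imsetP; exists z.
have [|x' _ Ex] := memA x; first by rewrite EA !inE eqxx.
have [|y' _ Ey] := memA y; first by rewrite EA !inE eqxx orbT.
have gg := mono_mul_inj2 (adj_neq xy) Ex Ey; split=> //.
by apply: val_inj; move: E; rewrite gg => /imset_inj; apply; apply: mono_mul_injl.
Qed.

Lemma power_edge_surj (Q : edge P) :
  exists p : edge G * mono G (k - 1), power_edge p.1 p.2 == Q.
Proof.
have [m [m' [/rpower_adjP[x [y [g [xy -> ->]]]] E]]] := edgeP Q.
exists (mkedge xy, g); by rewrite -val_eqE E (val_power_edge _ (val_mkedge xy)).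
Qed.

Definition edge_dec Q := xchoose (power_edge_surj Q).

Lemma edge_decK Q : power_edge (edge_dec Q).1 (edge_dec Q).2 = Q.
Proof. exact/eqP/(xchooseP (power_edge_surj Q)). Qed.

Lemma power_edgeK A g : edge_dec (power_edge A g) = (A, g).
Proof.
have := edge_decK (power_edge A g).
by case: (edge_dec _) => A' g' /= /power_edge_inj[-> ->].
Qed.

Lemma power_edge_eq A A' g g' :
  (power_edge A g == power_edge A' g') = (A == A') && (g == g').
Proof.
apply/eqP/andP => [/power_edge_inj[-> ->]//|[/eqP-> /eqP->]//].
Qed.

Lemma sum_power_edge (F : edge P -> 'F_2) :
  \sum_Q F Q = \sum_A \sum_g F (power_edge A g).
Proof.
rewrite pair_big (reindex (fun p => power_edge p.1 p.2)) //=.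
by exists edge_dec => [[A g]|Q] _; rewrite ?power_edgeK ?edge_decK.
Qed.

Lemma lift_setE (A : edge G) (g : mono G (k - 1)) :
  mono_set k [seq mmul (ucm x) (val g) | x <- enum (val A)] = val (power_edge A g).
Proof.
apply/setP => m; rewrite inE; apply/mapP/imsetP => -[x xA E].
  by exists x; rewrite ?mem_enum in xA *; last exact: val_inj.
by exists x; rewrite ?mem_enum // E.
Qed.

Fact lift_is_linear f : linear (@lift_chain G k f).
Proof.
move=> c z w; rewrite /lift_chain scaler_sumr -big_split /=.
by apply: eq_bigr => A _; rewrite !ffunE scalerDl scalerA.
Qed.

HB.instance Definition _ f :=
  GRing.isLinear.Build 'F_2 (chain G) (chain P) _ (@lift_chain G k f)
    (lift_is_linear f).

Lemma lift_chainE f z A g :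
  lift_chain f z (power_edge A g) = if g == f then z A else 0.
Proof.
rewrite sum_ffunE (bigD1 A) //= big1 => [|A' A'A].
  rewrite !ffunE lift_setE val_eqE power_edge_eq eqxx addr0.
  by case: eqP; rewrite ?scaler0 // /GRing.scale /= mulr1.
rewrite !ffunE lift_setE val_eqE power_edge_eq eq_sym (negbTE A'A).
by rewrite scaler0.
Qed.

Definition proj (z : chain P) : chain G := [ffun A => \sum_g z (power_edge A g)].

Fact proj_is_linear : linear proj.
Proof.
move=> c z w; apply/ffunP => A; rewrite !ffunE scaler_sumr -big_split /=.
by apply: eq_bigr => g _; rewrite !ffunE.
Qed.

HB.instance Definition _ :=
  GRing.isLinear.Build 'F_2 (chain P) (chain G) _ proj proj_is_linear.

Lemma projD z w : proj (z + w) = proj z + proj w.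
Proof. exact: linearD. Qed.

Lemma proj_lift f : cancel (@lift_chain G k f) proj.
Proof.
move=> z; apply/ffunP => A; rewrite ffunE (bigD1 f) //= big1 => [|g gf].
  by rewrite lift_chainE eqxx addr0.
by rewrite lift_chainE (negbTE gf).
Qed.

Lemma proj_edge_chain A g : proj (edge_chain (val (power_edge A g))) = edge_chain (val A).
Proof.
apply/ffunP => A'; rewrite ffunE edge_chainE (bigD1 g) // big1 => [|g' g'g].
  by rewrite edge_chainE power_edge_eq eqxx andbT /= addr0.
by rewrite edge_chainE power_edge_eq (negbTE g'g) andbF.
Qed.

Lemma lift_cycle f z : z \in cycle_space G -> lift_chain f z \in cycle_space P.
Proof.
move=> /cycle_spaceP zC; apply/cycle_spaceP => m.
rewrite big_mkcond sum_power_edge.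
under eq_bigr => A _.
  rewrite (bigD1 f) //= lift_chainE eqxx big1 => [|g gf]; last first.
    by rewrite lift_chainE (negbTE gf) if_same.
  rewrite addr0; over.
rewrite -big_mkcond /=.
(* A vertex outside the copy of [G] given by [f] lies on no lifted edge. *)
have [/existsP[x /eqP->]|/existsPn mx] := boolP [exists x, m == vmul x f].
  rewrite -[RHS](zC x); apply: eq_bigl => A.
  exact: mem_vmul.
rewrite big1 // => A /imsetP[x _ mE]; by have := mx x; rewrite mE eqxx.
Qed.

(* Weight each vertex m of the power by the exponent of x in m: the two ends
   of the edge (A, g) then contribute 2 g(x) + [x in A]. *)
Lemma proj_cycle z : z \in cycle_space P -> proj z \in cycle_space G.
Proof.
move=> /cycle_spaceP zC; apply/cycle_spaceP => x.
pose F : edge P -> 'F_2 := z.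
have FC m : \sum_(Q : edge P | m \in val Q) F Q = 0 by apply: zC.
have S0 : \sum_(m : P) (val m x)%:R * (\sum_(Q : edge P | m \in val Q) F Q) = 0.
  by apply: big1 => m _; rewrite FC mulr0.
rewrite -[RHS]S0; under [RHS]eq_bigr do rewrite mulr_sumr.
rewrite (exchange_big_dep xpredT) //= sum_power_edge big_mkcond /=.
apply: eq_bigr => A _; rewrite ffunE.
have [u [w [uw EA]]] := edgeP A; have uNw := adj_neq uw.
have E g : \sum_(m in val (power_edge A g)) (val m x)%:R * F (power_edge A g)
         = if x \in val A then F (power_edge A g) else 0.
  rewrite -mulr_suml (val_power_edge _ EA) EA big_setU1 ?big_set1 /=; last first.
    by rewrite inE (inj_eq (@mono_mul_injl _ _ _ _ _)).
  rewrite !cmM !cmU !inE !natrD addrACA F2_addrr addr0 !(eq_sym x).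
  case: (eqVneq u x) => [<-|]; rewrite ?(eq_sym w) ?(negbTE uNw) ?addr0 ?add0r.
    by rewrite mul1r.
  by move=> _; case: (x == w); rewrite /= ?mul1r ?mul0r.
rewrite [RHS](eq_bigr _ (fun g _ => E g)); case: ifP => // _.
by rewrite big1.
Qed.

Lemma mono_setC (m m' : {cmonom G}) : mono_set k [:: m; m'] = mono_set k [:: m'; m].
Proof. by apply/setP => p; rewrite !inE orbC. Qed.

Lemma mono_set2 (m m' : P) : mono_set k [:: val m; val m'] = [set m; m'].
Proof.
apply/setP => p; rewrite in_set2 inE !in_cons in_nil orbF.
by apply/orP/orP => -[]/eqP h; [left|right|left|right]; apply/eqP;
  rewrite ?h //; apply: val_inj.
Qed.

Lemma mono_set_edge x y (xy : adj x y) z (g : mono G (k - 2)) :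
  mono_set k [:: mmul (mmul (ucm x) (ucm z)) (val g);
                 mmul (mmul (ucm y) (ucm z)) (val g)]
  = val (power_edge (mkedge xy) (gmul z g)).
Proof.
rewrite -!mulmA -[mmul (ucm x) _]/(val (vmul x (gmul z g))).
rewrite -[mmul (ucm y) _]/(val (vmul y (gmul z g))) mono_set2.
by rewrite (val_power_edge _ (val_mkedge xy)).
Qed.

(** The Koszul syzygy: component [(c + d) g] on the edge [ab] and [(a + b) g] on the edge [cd]. *)
Lemma squareE a b c d (ab : adj a b) (cd : adj c d) (g : mono G (k - 2)) :
  square a b c d g =
  \sum_(Q <- [:: power_edge (mkedge ab) (gmul c g);
                 power_edge (mkedge cd) (gmul b g);
                 power_edge (mkedge ab) (gmul d g);
                 power_edge (mkedge cd) (gmul a g)]) edge_chain (val Q).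
Proof.
rewrite /square !big_cons big_nil addr0 !addrA -!mono_set_edge.
rewrite (mulmC (ucm c) (ucm b)) (mulmC (ucm d) (ucm b)).
rewrite (mulmC (ucm c) (ucm a)) (mulmC (ucm d) (ucm a)).
pose w x y := mmul (mmul (ucm x) (ucm y)) (val g).
by rewrite (mono_setC (w b d) (w a d)) (mono_setC (w a d) (w a c)).
Qed.

Lemma mem_power_edge x y (xy : adj x y) g (m : P) :
  (m \in val (power_edge (mkedge xy) g))%:R
  = (m == vmul x g)%:R + (m == vmul y g)%:R :> 'F_2.
Proof.
rewrite (val_power_edge _ (val_mkedge xy)) !inE.
case: eqP => [->|_]; last by rewrite add0r.
by rewrite (inj_eq (@mono_mul_injl _ _ _ _ _)) (negbTE (adj_neq xy)) addr0.
Qed.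

Lemma square_cycle a b c d (g : mono G (k - 2)) : adj a b -> adj c d ->
  square a b c d g \in cycle_space P.
Proof.
move=> ab cd; apply/cycle_spaceP => m; rewrite squareE.
under eq_bigr do rewrite sum_ffunE.
rewrite exchange_big !big_cons big_nil !sum_edge_chain !mem_power_edge.
(* Once the factors commute, each corner is visibly an end of two of the four edges. *)
have gC x y : vmul x (gmul y g) = vmul y (gmul x g) by apply: mono_mulC.
rewrite (gC c b) (gC d b) (gC c a) (gC d a).
exact: F2_square.
Qed.

(** Opposite sides of the square project to the same edge and cancel. *)
Lemma proj_square a b c d (g : mono G (k - 2)) : adj a b -> adj c d ->
  proj (square a b c d g) = 0.
Proof.
move=> ab cd; rewrite squareE !big_cons big_nil addr0 !projD !proj_edge_chain.
by rewrite addrA chain_addrr.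
Qed.

Lemma proj_chain_length z : (chain_length (proj z) <= chain_length z)%N.
Proof.
apply: leq_trans (leq_imset_card (fun Q => (edge_dec Q).1) _).
apply/subset_leq_card/subsetP => A; rewrite inE => zA.
suff /existsP[g zg] : [exists g, z (power_edge A g) != 0].
  by apply/imsetP; exists (power_edge A g); rewrite ?inE ?power_edgeK.
apply: contraNT zA => /existsPn z0; rewrite ffunE big1 // => g _.
by apply/eqP; rewrite -[_ == _]negbK z0.
Qed.

Lemma lift_chain_length (f : mono G (k - 1)) z :
  (chain_length (lift_chain f z) <= chain_length z)%N.
Proof.
apply: leq_trans (leq_imset_card (power_edge^~ f) _).
apply/subset_leq_card/subsetP => Q; rewrite inE -(edge_decK Q).
case: (edge_dec Q) => A g /=; rewrite lift_chainE.
case: (g =P f) => [-> zA|_]; last by rewrite eqxx.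
by apply/imsetP; exists A; rewrite ?inE.
Qed.

Lemma square_length a b c d (g : mono G (k - 2)) : adj a b -> adj c d ->
  (chain_length (square a b c d g) <= 4)%N.
Proof. by move=> ab cd; apply: chain_length_edge_chains (squareE ab cd g). Qed.

(** Going round a triangle, the product of the variables removed equals that of the variables
    inserted, so [a c e = b d f] as monomials. *)
Lemma rpower_triangle_free : triangle_free G -> triangle_free P.
Proof.
move=> tf m1 m2 m3; apply/negP => /and3P[].
move=> /rpower_adjP[a [b [g [ab e1 e2]]]] /rpower_adjP[c [d [h [cd e3 e4]]]].
move=> /rpower_adjP[e [f [l [ef e5 e6]]]].
have N u : ((a == u) + (c == u) + (e == u) = (b == u) + (d == u) + (f == u))%N.
  have S (A B C D E F p q s x y w : nat) : (x = A + p -> y = B + p ->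
    y = C + q -> w = D + q -> w = E + s -> x = F + s -> A + C + E = B + D + F)%N.
    by lia.
  have V x l' m : m = vmul x l' -> val m u = ((x == u) + val l' u)%N.
    by move=> ->; apply: mono_mulE.
  exact: S (V _ _ _ e1) (V _ _ _ e2) (V _ _ _ e3) (V _ _ _ e4) (V _ _ _ e5) (V _ _ _ e6).
have /negbTE aNb := adj_neq ab; have /negbTE cNd := adj_neq cd.
have /negbTE eNf := adj_neq ef.
(* Since [a] differs from [b], it equals [d] or [f]; in either case the edges [ab], [cd], [ef] close
   up to a triangle of [G]. *)
have [ad|ad] := eqVneq d a.
  subst d; have /eqP eb : b == e.
    by have := N e; rewrite eqxx (eq_sym f) eNf; do 3?case: (_ == _).
  subst e; have /eqP fc : c == f.
    by have := N c; rewrite eqxx (eq_sym f); do 3?case: (_ == _).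
  by subst f; have := tf a b c; rewrite ab ef cd.
have /eqP fa : f == a.
  by have := N a; rewrite eqxx (eq_sym b) aNb (negbTE ad); do 3?case: (_ == _).
subst f; have /eqP bc : b == c.
  by have := N c; rewrite eqxx (eq_sym d) cNd; do 3?case: (_ == _).
subst c; have /eqP de : e == d.
  by have := N d; rewrite eqxx; do 3?case: (_ == _).
by subst e; have := tf a b d; rewrite ab cd ef.
Qed.

End Power.

(** * Squares and their leading edges *)

Section Squares.
Variables (G : sgraph) (k : nat) (k_ge2 : (2 <= k)%N).
Variables (t : rel G) (r : G) (t_tree : spanning_tree t).
Variables (v : nat) (a : 'I_v -> G) (a_lab : rooted_labelling t r a).

Notation P := (rpower G k).
Notation B := (@square_set G k t r v a).
Notation pe := (power_edge k_ge2).
Notation gmul := (gmul k_ge2).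
Notation vmul := (vmul k_ge2).
Notation prt := (parent t r).
Notation lb x := (label a_lab x).

Definition upto n (x : G) (g : mono G n) : Prop :=
  forall y, (lb x < lb y)%N -> val g y = 0%N.

Lemma mono_uptoP n (j : 'I_v) (g : mono G n) :
  reflect (upto (a j) g) (mono_upto a j g).
Proof.
apply: (iffP forallP) => [h y|h i].
  rewrite aK => jy; have := h (lb y); rewrite labelK jy.
  by move/eqP.
by apply/implyP => ji; apply/eqP/h; rewrite !aK.
Qed.

Lemma top_variable n (g : mono G n) : (0 < n)%N ->
  exists2 x, (0 < val g x)%N & upto x g.
Proof.
move=> /mono_neq1-/(_ _ g)[x0 gx0].
have [x gx xmax] := @arg_maxnP _ x0 (fun x => 0 < val g x)%N (fun x => lb x) gx0.
exists x => // y xy; apply/eqP; rewrite eqn0Ngt; apply/negP => /xmax.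
by rewrite /geq /= leqNgt xy.
Qed.

(** Here [x] is the top variable of the product, so the product determines it and then [g]. *)
Lemma mono_mul_top_inj n n' (e : n.+1 = n') x x' (g g' : mono G n) :
  upto x g -> upto x' g' -> mono_mul e x g = mono_mul e x' g' -> x = x' /\ g = g'.
Proof.
move=> ug ug' E.
have le y y' (h h' : mono G n) : upto y' h' ->
    mono_mul e y h = mono_mul e y' h' -> (lb y <= lb y')%N.
  move=> uh' /(congr1 (fun m : mono G n' => val m y)); rewrite !mono_mulE eqxx.
  rewrite leqNgt => Eh; apply/negP => lt; move: Eh; rewrite (uh' y) //.
  by case: eqP lt => // ->; rewrite ltnn.
have xx : x = x'.
  apply: (can_inj (labelK a_lab)); apply: val_inj; apply/eqP; rewrite eqn_leq.
  by rewrite (le _ _ _ _ ug' E) (le _ _ _ _ ug (esym E)).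
by split=> //; rewrite -xx in E; apply: mono_mul_injr E.
Qed.

(** Chosen so that replacing a variable by its parent lowers it. *)
Definition weight n (m : mono G n) : nat := (\sum_x val m x * lb x)%N.

Lemma weight_mul n n' (e : n.+1 = n') x (g : mono G n) :
  weight (mono_mul e x g) = (lb x + weight g)%N.
Proof.
rewrite /weight; under eq_bigr do rewrite mono_mulE mulnDl.
rewrite big_split /=; congr (_ + _)%N; rewrite (bigD1 x) //= eqxx mul1n.
by rewrite big1 ?addn0 // => y; rewrite eq_sym => /negbTE->.
Qed.

Definition parent_edge x (xr : x != r) : edge G := mkedge (adj_parent t_tree xr).

Definition cotree (A : edge G) : Prop :=
  forall x, x != r -> val A <> [set x; prt x].

Lemma edge_tree_or_cotree (A : edge G) :
  (exists x (xr : x != r), A = parent_edge xr) \/ cotree A.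
Proof.
have [/existsP[x /andP[xr /eqP E]]|/existsPn h] :=
    boolP [exists x, (x != r) && (val A == [set x; prt x])].
  by left; exists x, xr; apply: val_inj.
by right=> x xr E; have := h x; rewrite xr E eqxx.
Qed.

Lemma cotreeP x y (xy : adj x y) : cotree (mkedge xy) <-> ~~ t x y.
Proof.
have [tS _ _ _] := t_tree; split=> [co|nt].
  apply/negP => /(tree_edge_parent r t_tree)[[xr yE]|[yr xE]].
    by apply: (co x xr); rewrite -yE.
  by apply: (co y yr); rewrite -xE [LHS]setUC.
move=> u ur E; case/negP: nt; have [tu _] := parentP t_tree ur.
have : x \in val (mkedge xy) by rewrite !inE eqxx.
have : y \in val (mkedge xy) by rewrite !inE eqxx orbT.
have := adj_neq xy; rewrite E !inE => + /orP[]/eqP yE /orP[]/eqP xE.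
all: by rewrite xE yE ?eqxx // tS.
Qed.

(** Non-root labels are positive, so edges outside the tree lie strictly above all parent edges;
    among the latter, smaller labels lie higher. *)
Definition edge_level (A : edge G) : nat :=
  if [pick x | (x != r) && (val A == [set x; prt x])] is Some x
  then (v - lb x)%N else v.

Lemma level_parent x (xr : x != r) : edge_level (parent_edge xr) = (v - lb x)%N.
Proof.
rewrite /edge_level; case: pickP => [y /andP[yr /eqP/= E]|/(_ x)].
  by rewrite (parent_edge_inj t_tree a_lab xr yr E).
by rewrite xr eqxx.
Qed.

Lemma level_cotree A : cotree A -> edge_level A = v.
Proof.
move=> co; rewrite /edge_level; case: pickP => // x /andP[xr /eqP/(co x xr)].
by [].
Qed.

(* Lexicographic order: by level (edges outside the tree highest, then e_2, e_3, ...),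
   then by weight. *)
Definition edge_rank (Q : edge P) : nat :=
  let p := edge_dec k_ge2 Q in
  (edge_level p.1 * (\max_(g : mono G (k - 1)) weight g).+1 + weight p.2)%N.

(** The factor of the level exceeds every weight, so no weight makes up for a lower level. *)
Lemma edge_rank_level A A' g g' :
  (edge_level A < edge_level A')%N -> (edge_rank (pe A g) < edge_rank (pe A' g'))%N.
Proof.
rewrite /edge_rank !power_edgeK /= => lt.
apply: leq_trans (leq_addr _ _); apply: leq_trans (leq_mul lt (leqnn _)).
by rewrite mulSn addnC ltn_add2r ltnS (leq_bigmax g).
Qed.

Lemma edge_rank_weight A g g' :
  (weight g < weight g')%N -> (edge_rank (pe A g) < edge_rank (pe A g'))%N.
Proof. by rewrite /edge_rank !power_edgeK /= ltn_add2l. Qed.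

(** The two sides along the parent edge of [z] have lower level; of the two along [xy], the one at
    [z] has larger weight than the one at the parent of [z]. *)
Lemma square_leads x y (xy : adj x y) z (zr : z != r) (g : mono G (k - 2)) :
  (edge_level (parent_edge zr) < edge_level (mkedge xy))%N ->
  leads edge_rank (square x y z (prt z) g) (pe (mkedge xy) (gmul z g)).
Proof.
move=> lt; have DA : mkedge xy == parent_edge zr = false.
  by apply/eqP => E; rewrite E ltnn in lt.
rewrite (squareE k_ge2 xy (adj_parent t_tree zr)) -/(parent_edge zr).
have zp := label_parent t_tree a_lab zr.
have gz : gmul z g == gmul (prt z) g = false.
  by apply/eqP => /mono_mul_injl zz; rewrite -zz ltnn in zp.
set z4 := \sum_(Q <- _) _.
have z4E R : z4 R = (R == pe (mkedge xy) (gmul z g))%:R +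
  ((R == pe (parent_edge zr) (gmul y g))%:R +
  ((R == pe (mkedge xy) (gmul (prt z) g))%:R +
  ((R == pe (parent_edge zr) (gmul x g))%:R + 0))) :> 'F_2.
  by rewrite /z4 sum_ffunE !big_cons big_nil !edge_chainE.
apply/leadsP; split=> [|R].
  by rewrite z4E !power_edge_eq !eqxx DA gz.
rewrite z4E => + /negbTE RQ; rewrite RQ.
case: (R =P _) => [-> _|_]; first exact: edge_rank_level.
case: (R =P _) => [-> _|_]; last first.
  by case: (R =P _) => [-> _|_]; [exact: edge_rank_level|rewrite !mulr0n !addr0 eqxx].
by apply: edge_rank_weight; rewrite !weight_mul ltn_add2r.
Qed.

Lemma Omega_mem x y z (g : mono G (k - 2)) : adj x y -> ~~ t x y -> z != r ->
  upto z g -> square x y z (prt z) g \in B.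
Proof.
move=> xy nt zr ug; rewrite !inE; apply/orP; right.
apply/existsP; exists (x, y); apply/existsP; exists (lb z); apply/existsP; exists g.
rewrite labelK; apply/and4P; split; rewrite ?xy ?label_gt0 //.
by apply/mono_uptoP; rewrite labelK.
Qed.

Lemma Upsilon_mem x z (g : mono G (k - 2)) : x != r -> (lb x < lb z)%N ->
  upto z g -> square x (prt x) z (prt z) g \in B.
Proof.
move=> xr xz ug; rewrite !inE; apply/orP; left.
apply/existsP; exists (lb x); apply/existsP; exists (lb z); apply/existsP; exists g.
rewrite !labelK; apply/and3P; split; rewrite ?label_gt0 ?xr //.
by apply/mono_uptoP; rewrite labelK.
Qed.

(** Puts [Upsilon] and [Omega] in one form: the first edge, an earlier tree edge or one outside the
    tree, has the higher level. *)
Lemma square_setP z : z \in B -> exists x y (xy : adj x y) u (ur : u != r) g,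
  [/\ z = square x y u (prt u) g, upto u g
    & (edge_level (parent_edge ur) < edge_level (mkedge xy))%N].
Proof.
rewrite !inE => /orP[/existsP[i]|/existsP[[x y]]] /existsP[j /existsP[g]].
  case/and3P=> /andP[i0 ij] /mono_uptoP ug /eqP->.
  have ir := a_neq_root a_lab i0.
  have jr := a_neq_root a_lab (ltn_trans i0 ij).
  exists (a i), (prt (a i)), (adj_parent t_tree ir), (a j), jr, g; split=> //.
  by rewrite -/(parent_edge ir) !level_parent !aK ltn_sub2l.
case/and4P=> /andP[/= xy nt] j0 /mono_uptoP ug /eqP->.
have jr := a_neq_root a_lab j0.
exists x, y, xy, (a j), jr, g; split=> //.
rewrite level_parent (level_cotree ((cotreeP xy).2 nt)) aK.
by rewrite ltn_subrL j0 (leq_ltn_trans _ (ltn_ord j)).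
Qed.

Lemma square_set_cycle z : z \in B -> z \in cycle_space P.
Proof.
case/square_setP=> x [y [xy [u [ur [g [-> _ _]]]]]].
exact: (square_cycle k_ge2 g xy (adj_parent t_tree ur)).
Qed.

Lemma proj_square_set z : z \in B -> proj k_ge2 z = 0.
Proof.
case/square_setP=> x [y [xy [u [ur [g [-> _ _]]]]]].
exact: (proj_square k_ge2 g xy (adj_parent t_tree ur)).
Qed.

Lemma square_set_length z : z \in B -> (chain_length z <= 4)%N.
Proof.
case/square_setP=> x [y [xy [u [ur [g [-> _ _]]]]]].
exact: (square_length k_ge2 g xy (adj_parent t_tree ur)).
Qed.

(** Needed because a leading edge yields its edge of [G] only as an unordered pair. *)
Lemma square_swap x y z u (g : mono G (k - 2)) :
  square x y z u g = square y x z u g.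
Proof.
pose w p q := mmul (mmul (ucm p) (ucm q)) (val g).
have AC (e1 e2 e3 e4 : chain P) : e1 + e2 + e3 + e4 = e1 + e4 + e3 + e2.
  by rewrite addrAC (addrAC e1) addrAC.
rewrite /square (mono_setC k (w y z) (w x z)) (mono_setC k (w x z) (w x u)).
rewrite (mono_setC k (w x u) (w y u)) (mono_setC k (w y u) (w y z)).
exact: AC.
Qed.

Lemma square_set_leads z : z \in B -> exists Q, leads edge_rank z Q.
Proof.
case/square_setP=> x [y [xy [u [ur [g [-> _ lt]]]]]].
by exists (pe (mkedge xy) (gmul u g)); apply: square_leads lt.
Qed.

(** The leading edge gives the first edge and the monomial [u g]; as [g] has no variable above [u],
    the latter gives [u] and [g]. *)
Lemma square_set_leads_inj z w Q : z \in B -> w \in B ->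
  leads edge_rank z Q -> leads edge_rank w Q -> z = w.
Proof.
case/square_setP=> x [y [xy [u [ur [g [-> ug lt]]]]]].
case/square_setP=> x' [y' [xy' [u' [ur' [g' [-> ug' lt']]]]]].
move=> /leads_inj-/(_ _ (square_leads g lt))->.
move=> /leads_inj-/(_ _ (square_leads g' lt')) /power_edge_inj[/(congr1 val)/= E].
move=> /(mono_mul_top_inj ug ug')[<- <-].
have : x \in [set x'; y'] by rewrite -E !inE eqxx.
have : y \in [set x'; y'] by rewrite -E !inE eqxx orbT.
have xNy := adj_neq xy; rewrite !inE => /orP[]/eqP yE /orP[]/eqP xE.
- by case/eqP: xNy; rewrite xE yE.
- by rewrite xE yE square_swap.
- by rewrite xE yE.
by case/eqP: xNy; rewrite xE yE.
Qed.

Lemma square_set_free : free (enum B).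
Proof.
apply: (leads_free (rk := edge_rank)); last exact: enum_uniq.
  by move=> z; rewrite mem_enum; apply: square_set_leads.
by move=> z w Q; rewrite !mem_enum; apply: square_set_leads_inj.
Qed.

(** Splitting the top variable [x] off [g] leaves the monomial of a square in [Omega]; [x] is not
    the root because [y] is not. *)
Lemma cotree_leading (A : edge G) (g : mono G (k - 1)) y :
  cotree A -> (0 < val g y)%N -> y != r ->
  exists2 z, z \in B & leads edge_rank z (pe A g).
Proof.
move=> co gy yr; have k1 : (0 < k - 1)%N by rewrite subn_gt0.
have [x gx ug] := top_variable g k1.
have xr : x != r.
  rewrite -(label_gt0 a_lab); apply: leq_trans (_ : lb y <= _)%N.
    by rewrite label_gt0.
  by rewrite leqNgt; apply/negP => /ug g0; rewrite g0 in gy.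
have [h gE] := mono_div (power_succ2 k_ge2) gx.
have uh : upto x h.
  by move=> u /ug; rewrite gE mono_mulE => /eqP; rewrite addn_eq0 => /andP[_ /eqP].
have [p [q [pq EA]]] := edgeP A.
have {EA} EA : A = mkedge pq by apply: val_inj.
rewrite EA in co *; exists (square p q x (prt x) h).
  by apply: Omega_mem => //; apply/cotreeP.
rewrite gE; apply: (square_leads (zr := xr)).
rewrite level_parent level_cotree // ltn_subrL label_gt0 xr.
exact: leq_ltn_trans (ltn_ord (lb x)).
Qed.

(** The top variable of [g] lies above [x]; splitting it off gives a square in [Upsilon]. *)
Lemma parent_edge_leading x (xr : x != r) (g : mono G (k - 1)) y :
  (0 < val g y)%N -> (lb x < lb y)%N ->
  exists2 z, z \in B & leads edge_rank z (pe (parent_edge xr) g).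
Proof.
move=> gy xy; have k1 : (0 < k - 1)%N by rewrite subn_gt0.
have [z gz ug] := top_variable g k1.
have xz : (lb x < lb z)%N.
  apply: leq_trans xy _.
  by rewrite leqNgt; apply/negP => /ug g0; rewrite g0 in gy.
have zr : z != r by rewrite -(label_gt0 a_lab) (leq_ltn_trans _ xz).
have [h gE] := mono_div (power_succ2 k_ge2) gz.
have uh : upto z h.
  by move=> u /ug; rewrite gE mono_mulE => /eqP; rewrite addn_eq0 => /andP[_ /eqP].
exists (square x (prt x) z (prt z) h); first exact: Upsilon_mem.
rewrite gE; apply: (square_leads (zr := zr)).
by rewrite -/(parent_edge xr) !level_parent ltn_sub2l.
Qed.

Lemma root_power_unique n (g h : mono G n) :
  (forall y, y != r -> val g y = 0%N) -> (forall y, y != r -> val h y = 0%N) -> g = h.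
Proof.
have deg (m : mono G n) : (forall y, y != r -> val m y = 0%N) -> val m r = n.
  move=> m0; rewrite -[RHS](eqP (valP m)) (@mdegEw _ _ [fset r]%fset).
    by rewrite big_seq_fset1.
  apply/fsubsetP => y; rewrite -cmE_neq0 inE; apply: contraNT => /m0 ->.
  by [].
move=> g0 h0; apply: mono_eqP => y; have [->|yr] := eqVneq y r.
  by rewrite !deg.
by rewrite g0 // h0.
Qed.

(* The edges (e_i, g) with g a monomial in a_1, ..., a_i form a spanning tree of
   the power: the parent of a vertex m with top variable a_i is obtained by
   replacing one a_i by its parent. *)
Lemma cycle_on_tree_eq0 z : z \in cycle_space P ->
  (forall A g, cotree A -> z (pe A g) = 0) ->
  (forall x (xr : x != r) g, z (pe (parent_edge xr) g) != 0 -> upto x g) ->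
  z = 0.
Proof.
move=> zC zco zup.
have zQ Q : z Q != 0 -> exists x (xr : x != r) g, Q = pe (parent_edge xr) g /\ upto x g.
  rewrite -(edge_decK k_ge2 Q); case: (edge_dec _ _) => A g /=.
  have [[x [xr ->]]|co] := edge_tree_or_cotree A; last by rewrite zco ?eqxx.
  by move=> /zup; exists x, xr, g.
apply/eqP/negPn/negP => /chain_neq0[Q0 zQ0].
have mem1 x (xr : x != r) g : vmul x g \in val (pe (parent_edge xr) g).
  by rewrite mem_vmul !inE eqxx.
pose S (m : P) := [exists Q : edge P, (z Q != 0) && (m \in val Q)].
have [m0 Sm0] : exists m, S m.
  have [x [xr [g [E _]]]] := zQ Q0 zQ0; exists (vmul x g); apply/existsP.
  by exists Q0; rewrite zQ0 E mem1.
(* At a vertex of maximal weight in the support, every support edge leads to its parent; that edge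
   is unique, contradicting parity. *)
have [m Sm mmax] := @arg_maxnP _ m0 S (fun m => weight m) Sm0.
have top Q : z Q != 0 -> m \in val Q ->
    exists x (xr : x != r) g, [/\ Q = pe (parent_edge xr) g, upto x g & m = vmul x g].
  move=> zQn mQ; have [x [xr [g [E ug]]]] := zQ Q zQn.
  exists x, xr, g; split=> //.
  move: mQ; rewrite E (val_power_edge k_ge2 _ (val_mkedge (adj_parent t_tree xr))).
  rewrite in_set2 => /orP[]/eqP // mE.
  have /mmax : S (vmul x g) by apply/existsP; exists Q; rewrite zQn E mem1.
  rewrite /geq /= mE !weight_mul leq_add2r leqNgt.
  by rewrite label_parent.
have /existsP[Q /andP[zQn mQ]] := Sm.
have [Q' [zQ'n mQ' QQ']] := cycle_other_edge zC zQn mQ.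
have [x [xr [g [E ug mE]]]] := top Q zQn mQ.
have [x' [xr' [g' [E' ug' mE']]]] := top Q' zQ'n mQ'.
case/eqP: QQ'; rewrite E E'; move: mE'; rewrite mE => /(mono_mul_top_inj ug ug')[xx gg].
by subst x'; rewrite gg; congr (pe _ _); apply: val_inj.
Qed.

Lemma proj_kernel z : z \in cycle_space P -> proj k_ge2 z = 0 -> z \in <<enum B>>%VS.
Proof.
move=> zC pz0.
have [u uB uP] : exists2 u, u \in <<enum B>>%VS &
    forall w Q, w \in enum B -> leads edge_rank w Q -> (z - u) Q = 0.
  apply: leads_reduce.
  by move=> w w' Q; rewrite !mem_enum; apply: square_set_leads_inj.
suff /eqP : z - u = 0 by rewrite subr_eq0 => /eqP->.
have uC : u \in cycle_space P.
  apply: subvP uB; apply/span_subvP => w; rewrite mem_enum.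
  exact: square_set_cycle.
have pu0 : proj k_ge2 (z - u) = 0.
  rewrite linearB /= pz0 sub0r; apply/eqP; rewrite oppr_eq0.
  have : u \in lker (linfun (proj k_ge2)); last by rewrite memv_ker lfunE.
  apply: subvP uB; apply/span_subvP => w; rewrite mem_enum memv_ker lfunE => wB.
  by rewrite /= proj_square_set.
have vanish A (g : mono G (k - 1)) y :
    cotree A -> (0 < val g y)%N -> y != r -> (z - u) (pe A g) = 0.
  move=> co gy yr; have [w wB wl] := cotree_leading co gy yr.
  by apply: (uP w); rewrite ?mem_enum.
have zuC : z - u \in cycle_space P by apply: memvB.
move: (z - u) zuC uP pu0 vanish => y yC yP py0 vanish.
apply: cycle_on_tree_eq0 => // [A g co|x xr g].
  have [/existsP[w /andP[wr gw]]|/existsPn g0] :=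
      boolP [exists w, (w != r) && (0 < val g w)%N].
    exact: vanish gw wr.
  have {}g0 w : w != r -> val g w = 0%N.
    by move=> wr; have := g0 w; rewrite wr /= -eqn0Ngt => /eqP.
  (* Here [g] is a power of the root; all other terms over [A] vanish, so the zero projection kills
     this one too. *)
  have /ffunP/(_ A) := py0; rewrite !ffunE (bigD1 g) //= big1 ?addr0 // => h hg.
  have [/existsP[w /andP[wr hw]]|/existsPn h0] :=
      boolP [exists w, (w != r) && (0 < val h w)%N].
    exact: vanish hw wr.
  case/eqP: hg; apply: root_power_unique => // w wr.
  by have := h0 w; rewrite wr /= -eqn0Ngt => /eqP.
(* A variable of [g] above [x] would make this a leading edge, where the reduced cycle vanishes. *)
move=> ynz w xw; apply/eqP; rewrite eqn0Ngt; apply: contra ynz => gw.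
have [q qB ql] := parent_edge_leading xr gw xw.
by apply/eqP/(yP q); rewrite ?mem_enum.
Qed.

End Squares.

(** * Bases of the power *)

Lemma total_length_perm (H : sgraph) (B : {set chain H}) (s : seq (chain H)) :
  perm_eq (enum B) s -> total_length B = (\sum_(z <- s) chain_length z)%N.
Proof. by move=> Bs; rewrite /total_length -big_enum /= (perm_big _ Bs). Qed.

Section Main.
Variables (G : sgraph) (k : nat) (k_ge2 : (2 <= k)%N).
Variables (t : rel G) (r : G) (t_tree : spanning_tree t).
Variables (v : nat) (a : 'I_v -> G) (a_lab : rooted_labelling t r a).
Variables (C : {set chain G}) (C_basis : cycle_basis C).
Variable f : mono G (k - 1).

Notation P := (rpower G k).
Notation B := (@square_set G k t r v a).
Notation prj := (proj k_ge2).
Notation lft := (@lift_chain G k f).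
Notation basis_seq := ([seq lft z | z <- enum C] ++ enum B).

Lemma lift_span : <<[seq lft z | z <- enum C]>>%VS = (linfun lft @: cycle_space G)%VS.
Proof.
rewrite -(span_basis C_basis) limg_span; congr <<_>>%VS.
by apply: eq_map => z; rewrite lfunE.
Qed.

(** The lift is a section of the projection, so the cycle space of the power is the direct sum of
    the lifted cycle space of [G] and the kernel, of which the squares are a basis. *)
Lemma lift_squares_basis : basis_of (cycle_space P) basis_seq.
Proof.
have lC : (linfun lft @: cycle_space G <= cycle_space P)%VS.
  apply/subvP => w /memv_imgP[z zC ->]; rewrite lfunE.
  exact: lift_cycle.
have BC : (<<enum B>> <= cycle_space P)%VS.
  by apply/span_subvP => z; rewrite mem_enum; apply: square_set_cycle a_lab z.
rewrite /basis_of span_cat lift_span; apply/andP; split.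
  rewrite eqEsubv subv_add lC BC /=; apply/subvP => z zC.
  rewrite -(subrK (lft (prj z)) z) addrC; apply: memv_add.
    apply/memv_imgP; exists (prj z); last by rewrite lfunE.
    exact: proj_cycle.
  have K := @proj_kernel G k k_ge2 t r t_tree v a a_lab (z - lft (prj z)).
  apply: K.
    apply: memvB => //; apply: lift_cycle => //; exact: proj_cycle.
  by rewrite linearB /= proj_lift subrr.
rewrite cat_free lift_span (square_set_free k_ge2 t_tree a_lab) /=; apply/andP; split.
  have -> : [seq lft z | z <- enum C] = [seq linfun lft z | z <- enum C].
    by apply: eq_map => z; rewrite lfunE.
  apply: basis_free (limg_basis_of _ C_basis).
  suff /eqP-> : lker (linfun lft) == 0%VS by rewrite capv0.
  by apply/lker0P => z w; rewrite !lfunE => /(can_inj (proj_lift k_ge2 f)).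
(* A lift spanned by squares has zero projection, but its projection is the cycle lifted. *)
apply/directv_addP/eqP; rewrite -subv0; apply/subvP => w.
rewrite memv_cap => /andP[/memv_imgP[z _ ->] lB].
have : lft z \in lker (linfun prj).
  rewrite lfunE in lB; apply: subvP lB; apply/span_subvP => u.
  rewrite mem_enum memv_ker lfunE => uB.
  by rewrite /= (proj_square_set k_ge2 t_tree a_lab).
rewrite memv_ker lfunE /= proj_lift => /eqP->.
by rewrite linear0 mem0v.
Qed.

(** Freeness rules out repetitions: lifts of distinct cycles are distinct, and none of them is a
    square of [B]. *)
Lemma perm_basis_seq :
  perm_eq (enum ([set lft z | z in C] :|: B)) basis_seq.
Proof.
apply: uniq_perm; first exact: enum_uniq.
  exact: free_uniq (basis_free lift_squares_basis).
move=> z; rewrite mem_enum in_setU mem_cat mem_enum; congr (_ || _).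
apply/imsetP/mapP => -[w wC ->]; exists w => //; move: wC; by rewrite mem_enum.
Qed.

Lemma lift_squares_length :
  (total_length ([set lft z | z in C] :|: B) <= total_length C + 4 * #|B|)%N.
Proof.
rewrite (total_length_perm perm_basis_seq) big_cat big_map !big_enum /=.
apply: leq_add.
  by apply: leq_sum => z _; apply: lift_chain_length.
rewrite mulnC -sum_nat_const; apply: leq_sum => z zB.
exact: (@square_set_length G k k_ge2 t r t_tree v a a_lab z zB).
Qed.

Lemma cycle_basis_length (D : {set chain P}) :
  (forall C' : {set chain G}, cycle_basis C' -> (total_length C <= total_length C')%N) ->
  triangle_free G -> cycle_basis D ->
  (total_length C + 4 * #|B| <= total_length D)%N.
Proof.
move=> Cmin tf Db.
(* The projection maps the cycle space of the power onto that of [G], so the images of [s] form a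
   cycle basis of [G]. *)
have [s [sD sF sS]] := free_image_subseq prj (enum D).
have sb : basis_of (cycle_space G) (map prj s).
  rewrite /basis_of sF andbT sS.
  have -> : [seq prj z | z <- enum D] = [seq linfun prj z | z <- enum D].
    by apply: eq_map => z; rewrite lfunE.
  rewrite -limg_span (span_basis Db) eqEsubv; apply/andP; split; apply/subvP => z.
    by case/memv_imgP=> w wC ->; rewrite lfunE; apply: proj_cycle.
  move=> zC; apply/memv_imgP; exists (lft z); first exact: lift_cycle.
  by rewrite lfunE /= proj_lift.
have us := free_uniq sF.
have perm_s : perm_eq (enum [set z in map prj s]) (map prj s).
  by apply: uniq_perm => // [|z]; rewrite ?enum_uniq // mem_enum inE.
have le1 : (total_length C <= \sum_(z <- s) chain_length z)%N.
  apply: leq_trans (Cmin [set z in map prj s] _) _.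
    by rewrite /cycle_basis (perm_basis _ perm_s).
  rewrite (total_length_perm perm_s) big_map.
  by apply: leq_sum => z _; apply: proj_chain_length.
have size_s : size s = #|C|.
  rewrite cardE -(size_map prj s).
  by rewrite -(size_basis (X := in_tuple _) sb) (size_basis (X := in_tuple _) C_basis).
have size_D : size (enum D) = (#|C| + #|B|)%N.
  rewrite -(size_basis (X := in_tuple _) Db).
  rewrite (size_basis (X := in_tuple _) lift_squares_basis).
  by rewrite size_cat size_map -!cardE.
pose s' := [seq z <- enum D | z \notin s].
have perm_D : perm_eq (enum D) (s ++ s').
  have E := subseq_uniqP (enum_uniq D) sD.
  by rewrite {1}E perm_sym perm_filterC.
rewrite (total_length_perm perm_D) big_cat /=; apply: leq_add => //.
(* Both cycle bases of the power have the same size, and [s] is as large as [C]. *)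
have -> : #|B| = size s'.
  by apply/eqP; rewrite -(eqn_add2l #|C|) -size_D -size_s -size_cat (perm_size perm_D).
rewrite mulnC -sum1_size big_distrl /= big_seq [leqRHS]big_seq.
apply: leq_sum => z zs'; rewrite mul1n.
have zD : z \in enum D by move: zs'; rewrite mem_filter => /andP[].
apply: cycle_length_ge4; first exact: rpower_triangle_free.
  by rewrite -(span_basis Db) memv_span.
exact: free_not0 (basis_free Db) zD.
Qed.

End Main.

Local Close Scope ring_scope.

Theorem theorem1 (G : sgraph) (v k : nat)
    (G_conn : connected G) (G_card : #|G| = v) (k_ge2 : 2 <= k)
    (C : {set chain G}) (C_basis : cycle_basis C)
    (t : rel G) (r : G) (a : 'I_v -> G)
    (t_tree : spanning_tree t) (a_lab : rooted_labelling t r a)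
    (f : mono G (k - 1)) :
  let B := @square_set G k t r v a in
  let Cf := [set lift_chain f z | z in C] in
  cycle_basis (Cf :|: B) /\
  (min_cycle_basis C -> triangle_free G -> min_cycle_basis (Cf :|: B)).
Proof.
move=> B Cf; have CfB : cycle_basis (Cf :|: B).
  rewrite /cycle_basis (perm_basis _ (perm_basis_seq k_ge2 t_tree a_lab C_basis f)).
  exact: lift_squares_basis.
split=> // -[_ Cmin] tf; split=> // D Db.
apply: leq_trans (lift_squares_length k_ge2 t_tree a_lab C_basis f) _.
exact: cycle_basis_length.
Qed.
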